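(* Let $K$ be a field. For each of the functors $H^d_{dR}$ ($d\in\mathbb{Z}$), $H^{p,q}_{\partial_1}$, $H^{p,q}_{\partial_2}$, $H^{p,q}_{BC}$, $H^{p,q}_{A}$ ($p,q\in\mathbb{Z}$), denoted $H$, there is a set $\mathcal{T}_H$ of zigzag shapes, depending only on $H$, such that for every bounded double complex $A$ over $K$ $$\dim H(A)=\sum_{Z\in\mathcal{T}_H}\operatorname{mult}_Z(A).$$ That is, the dimensions of these cohomology spaces are linear combinations, with coefficients $0$ or $1$, of the multiplicities $\operatorname{mult}_Z(A)$ of zigzags.
   Context: A double complex over a field $K$ is a bigraded $K$-vector space $A=\bigoplus_{p,q\in\mathbb{Z}}A^{p,q}$ with endomorphisms $\partial_1,\partial_2$ of bidegree $(1,0)$ and $(0,1)$ satisfying $\partial_1^2=\partial_2^2=0$ and $\partial_1\partial_2+\partial_2\partial_1=0$. It is bounded if $A^{p,q}=0$ for all but finitely many $(p,q)$. A shape is one of the following finite subsets of $\mathbb{Z}^2$. - Square shapes: $S^{p,q}=\{(p,q),(p-1,q),(p,q-1),(p-1,q-1)\}$. - Even zigzag shapes ($r\ge 1$): $S_{1,r}^{p,q}=\{(p+j,q-j),(p+j+1,q-j)\mid 0\le j\le r-1\}$ and $S_{2,r}^{p,q}=\{(p-j,q+j),(p-j,q+j+1)\mid 0\le j\le r-1\}$. - Odd zigzag shapes: if $p+q\le d$, $S_d^{p,q}=\{(j,d-j)\mid p\le j\le d-q\}\cup\{(j,d+1-j)\mid p+1\le j\le d-q\}$; if $p+q> d$,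 $S_d^{p,q}=\{(j,d-j)\mid d-q\le j\le p\}\cup\{(j,d-1-j)\mid d-q\le j\le p-1\}$. For a shape $S$, $C(S)$ is the (unique up to isomorphism) double complex that is one-dimensional in the bidegrees of $S$, zero elsewhere, with every component of $\partial_1,\partial_2$ between two bidegrees of $S$ an isomorphism. Every bounded double complex is isomorphic to $\bigoplus_S C(S)^{\oplus\operatorname{mult}_S(A)}$ for unique cardinals $\operatorname{mult}_S(A)$. Cohomologies: $H_{dR}^d(A)$ is the cohomology of the total complex $\bigoplus_{p+q=d}A^{p,q}$ with differential $\partial_1+\partial_2$; $H_{\partial_1}^{p,q}(A)=H^p(A^{\cdot,q},\partial_1)$; $H_{\partial_2}^{p,q}(A)=H^q(A^{p,\cdot},\partial_2)$; $H_{BC}^{p,q}(A)=\left(\frac{\ker\partial_1\cap\ker\partial_2}{\operatorname{im}\partial_1\partial_2}\right)^{p,q}$; $H_A^{p,q}(A)=\left(\frac{\ker\partial_1\partial_2}{\operatorname{im}\partial_1+\operatorname{im}\partial_2}\right)^{p,q}$. Dimensions are cardinal numbers. *)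

(* Defs.v *)
From HB Require Import structures.
From mathcomp Require Import all_boot all_order all_algebra ring_quotient.
From mathcomp Require Import boolp classical_sets functions cardinality.

Set Implicit Arguments.
Unset Strict Implicit.
Unset Printing Implicit Defensive.

Import Order.TTheory GRing.Theory Num.Theory.
Local Open Scope classical_set_scope.
Local Open Scope ring_scope.

Section Subspace.
Variables (K : fieldType) (V : lmodType K).

Record subspace (W : submodClosed V) :=
  Subspace { subspace_val :> V; _ : subspace_val \in W }.

Variable W : submodClosed V.
HB.instance Definition _ := [isSub of subspace W for @subspace_val W].
HB.instance Definition _ := [Choice of subspace W by <:].
HB.instance Definition _ := [SubChoice_isSubLmodule of subspace W by <:].
End Subspace.

(* [Quotient.quot] is the quotient of an additive group by a subgroup. *)
Section QuotientSpace.
Variables (K : fieldType) (V : lmodType K) (W : submodClosed V).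

(* [submodClosed] does not inherit from [zmodClosed]. *)
Definition subgroup_of : {pred V} := W.
HB.instance Definition _ :=
  GRing.isSubmodClosed.Build K V subgroup_of (GRing.submodClosedP W).

Definition quotient_space := Quotient.quot subgroup_of.
HB.instance Definition _ := GRing.Zmodule.on quotient_space.
HB.instance Definition _ := ZmodQuotient.on quotient_space.

Definition quotient_scale (a : K) (x : quotient_space) : quotient_space :=
  \pi_quotient_space%qT (a *: repr x).

Lemma pi_scale (a : K) (v : V) :
  quotient_scale a (\pi_quotient_space%qT v) = \pi_quotient_space%qT (a *: v).
Proof.
apply/eqP; rewrite /quotient_scale -Quotient.idealrBE -scalerBr.
by rewrite rpredZ // Quotient.idealrBE reprK.
Qed.

Lemma quotient_scalerA (a b : K) (x : quotient_space) :
  quotient_scale a (quotient_scale b x) = quotient_scale (a * b) x.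
Proof. by rewrite -[x]reprK (pi_scale b) (pi_scale a) pi_scale scalerA. Qed.

Lemma quotient_scale1r : left_id 1 quotient_scale.
Proof. by move=> x; rewrite -[x]reprK pi_scale scale1r. Qed.

Lemma quotient_scalerDr : right_distributive quotient_scale +%R.
Proof.
move=> a x y; rewrite -[x]reprK -[y]reprK -raddfD.
by rewrite (pi_scale a (_ + _)) (pi_scale a (repr x)) (pi_scale a (repr y)) scalerDr raddfD.
Qed.

Lemma quotient_scalerDl (x : quotient_space) :
  {morph quotient_scale^~ x : a b / a + b}.
Proof. by move=> a b; rewrite -[x]reprK !(pi_scale _ (repr x)) scalerDl raddfD. Qed.

HB.instance Definition _ := GRing.Zmodule_isLmodule.Build K quotient_space
  quotient_scalerA quotient_scale1r quotient_scalerDr quotient_scalerDl.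
End QuotientSpace.

Section Subquotient.
Variables (K : fieldType) (V : lmodType K) (Z B : submodClosed V).

Definition subspace_restr : {pred subspace Z} := [pred z | val z \in B].

Lemma subspace_restr_closed : submod_closed subspace_restr.
Proof.
split=> [|a u v]; rewrite !inE; first by rewrite raddf0 rpred0.
by move=> uB vB; rewrite linearP /= rpredD ?rpredZ.
Qed.

HB.instance Definition _ :=
  GRing.isSubmodClosed.Build K (subspace Z) subspace_restr subspace_restr_closed.

(* The quotient of Z by its intersection with B; it is Z / B when B is
   contained in Z, as is the case in all uses (lemma [coboundary_sub]). *)
Definition subquotient : lmodType K := quotient_space subspace_restr.
End Subquotient.

Section Dimension.
Variables (K : fieldType) (V : lmodType K).

Definition is_basis (I : Type) (b : I -> V) : Prop :=
  (forall (n : nat) (f : 'I_n -> I) (c : 'I_n -> K), injective f ->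
     \sum_(j < n) c j *: b (f j) = 0 -> forall j, c j = 0) /\
  (forall v : V, exists (n : nat) (f : 'I_n -> I) (c : 'I_n -> K),
     v = \sum_(j < n) c j *: b (f j)).

(* dim V = |I|; a cardinal number is represented by any type I of that
   cardinality. *)
Definition has_dim (I : Type) : Prop := exists b : I -> V, is_basis b.
End Dimension.

Section DirectProduct.
Variables (K : fieldType) (I : Type) (V : I -> lmodType K).

Definition dprod := forall i, V i.
HB.instance Definition _ := Choice.on dprod.

Definition dprod_zero : dprod := fun=> 0.
Definition dprod_opp (f : dprod) : dprod := fun i => - f i.
Definition dprod_add (f g : dprod) : dprod := fun i => f i + g i.
Definition dprod_scale (a : K) (f : dprod) : dprod := fun i => a *: f i.

Lemma dprod_addA : associative dprod_add.
Proof. by move=> f g h; apply/functional_extensionality_dep => i; exact: addrA. Qed.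
Lemma dprod_addC : commutative dprod_add.
Proof. by move=> f g; apply/functional_extensionality_dep => i; exact: addrC. Qed.
Lemma dprod_add0 : left_id dprod_zero dprod_add.
Proof. by move=> f; apply/functional_extensionality_dep => i; exact: add0r. Qed.
Lemma dprod_addN : left_inverse dprod_zero dprod_opp dprod_add.
Proof. by move=> f; apply/functional_extensionality_dep => i; exact: addNr. Qed.

HB.instance Definition _ :=
  GRing.isZmodule.Build dprod dprod_addA dprod_addC dprod_add0 dprod_addN.

Lemma dprod_scalerA (a b : K) (f : dprod) :
  dprod_scale a (dprod_scale b f) = dprod_scale (a * b) f.
Proof. by apply/functional_extensionality_dep => i; exact: scalerA. Qed.
Lemma dprod_scale1r : left_id 1 dprod_scale.
Proof. by move=> f; apply/functional_extensionality_dep => i; exact: scale1r. Qed.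
Lemma dprod_scalerDr : right_distributive dprod_scale +%R.
Proof. by move=> a f g; apply/functional_extensionality_dep => i; exact: scalerDr. Qed.
Lemma dprod_scalerDl (f : dprod) : {morph dprod_scale^~ f : a b / a + b}.
Proof. by move=> a b; apply/functional_extensionality_dep => i; exact: scalerDl. Qed.

HB.instance Definition _ := GRing.Zmodule_isLmodule.Build K dprod
  dprod_scalerA dprod_scale1r dprod_scalerDr dprod_scalerDl.

Definition finite_support : {pred dprod} :=
  fun f => `[< finite_set [set i | f i != 0] >].

Lemma finite_support_closed : submod_closed finite_support.
Proof.
split=> [|a f g].
  apply/asboolP; apply: (sub_finite_set _ (finite_set0 I)) => i /=.
  by rewrite eqxx.
move=> /asboolP ff /asboolP fg; apply/asboolP.
apply: (@sub_finite_set _ _ ([set i | f i != 0] `|` [set i | g i != 0]));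
  last by rewrite finite_setU.
move=> i /=; apply: contraPP => /not_orP [/negP + /negP].
rewrite !negbK => /eqP fi0 /eqP gi0; apply/negP; rewrite negbK.
by apply/eqP; rewrite -[LHS]/(a *: f i + g i) fi0 gi0 scaler0 addr0.
Qed.

HB.instance Definition _ :=
  GRing.isSubmodClosed.Build K dprod finite_support finite_support_closed.

Definition dsum : lmodType K := subspace finite_support.
End DirectProduct.

Section DirectSumMap.
Variables (K : fieldType) (I : Type) (V : I -> lmodType K).
Variable phi : forall i, {linear V i -> V i}.

Lemma dsum_map_subproof (f : dsum V) :
  (fun i => phi i (val f i) : V i) \in @finite_support K I V.
Proof.
case: f => f /= /asboolP ff; apply/asboolP; apply: sub_finite_set ff => i /=.
by apply: contra => /eqP->; rewrite linear0.
Qed.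

Definition dsum_map (f : dsum V) : dsum V := Subspace (dsum_map_subproof f).

Lemma dsum_map_linear : linear dsum_map.
Proof.
move=> a f g; apply/val_inj; rewrite linearP.
by apply/functional_extensionality_dep => i; rewrite /= linearP.
Qed.

HB.instance Definition _ :=
  GRing.isLinear.Build K (dsum V) (dsum V) *:%R dsum_map dsum_map_linear.
End DirectSumMap.

(* A bigrading of the vector space [carrier] is given by the family of
   projections onto the bihomogeneous components: pairwise orthogonal
   idempotents such that each vector is the sum of finitely many of its
   components. *)
Record doubleComplex (K : fieldType) := DoubleComplex {
  carrier :> lmodType K;
  proj : int * int -> {linear carrier -> carrier};
  del1 : {linear carrier -> carrier};
  del2 : {linear carrier -> carrier};
  proj_id : forall x v, proj x (proj x v) = proj x v;
  proj_orth : forall x y v, x != y -> proj x (proj y v) = 0;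
  proj_sum : forall v, exists2 s : seq (int * int),
    uniq s & v = \sum_(x <- s) proj x v;
  (* del1 and del2 have bidegrees (1, 0) and (0, 1) *)
  del1_deg : forall p q v,
    proj (p, q) v = v -> proj (p + 1, q) (del1 v) = del1 v;
  del2_deg : forall p q v,
    proj (p, q) v = v -> proj (p, q + 1) (del2 v) = del2 v;
  del1_sq : forall v, del1 (del1 v) = 0;
  del2_sq : forall v, del2 (del2 v) = 0;
  del_anticomm : forall v, del1 (del2 v) + del2 (del1 v) = 0
}.
Arguments proj {K d}.
Arguments del1 {K d}.
Arguments del2 {K d}.

Section DoubleComplexTheory.
Variables (K : fieldType) (A : doubleComplex K).

(* the component A^{p,q}, for x = (p, q) *)
Definition homog (x : int * int) : {pred A} := [pred v | proj x v == v].

Lemma homog_closed x : submod_closed (homog x).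
Proof.
split=> [|a u v]; rewrite !inE ?linear0 //.
by move=> /eqP ux /eqP vx; rewrite linearP ux vx.
Qed.

HB.instance Definition _ x :=
  GRing.isSubmodClosed.Build K A (homog x) (homog_closed x).

Lemma homogP x v : reflect (proj x v = v) (v \in homog x).
Proof. exact: eqP. Qed.

Lemma eq_on_proj (f g : {linear A -> A}) :
  (forall x v, f (proj x v) = g (proj x v)) -> f =1 g.
Proof.
move=> fg v; have [s _ ->] := proj_sum v; rewrite !linear_sum.
by apply: eq_bigr => x _; exact: fg.
Qed.

Lemma proj_projE x y v : proj x (proj y v) = if x == y then proj y v else 0 :> A.
Proof. by have [->|] := eqVneq x y; [exact: proj_id|exact: proj_orth]. Qed.

Lemma proj_finite v : finite_set [set x | proj x v != 0 :> A].
Proof.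
have [s _ vE] := proj_sum v; apply: (sub_finite_set _ (finite_seq s)) => x /=.
apply: contraNT => xs; rewrite vE linear_sum big1_seq // => y /= ys.
by rewrite proj_orth //; apply: contraNneq xs => ->.
Qed.

Lemma proj_sum_sub (s : seq (int * int)) v :
  uniq s -> (forall x, proj x v != 0 :> A -> x \in s) ->
  v = \sum_(x <- s) proj x v.
Proof.
move=> us vs; have [t ut vE] := proj_sum v.
have vt x : proj x v != 0 -> x \in t.
  apply: contraNT => xt; rewrite vE linear_sum big1_seq // => y /= yt.
  by rewrite proj_orth //; apply: contraNneq xt => ->.
rewrite [LHS]vE (bigID (fun x => proj x v == 0)) big1 => [|x /eqP//].
rewrite [RHS](bigID (fun x => proj x v == 0)) [X in _ = X + _]big1 => [|x /eqP//].
rewrite /= !add0r -big_filter -[in RHS]big_filter; apply: perm_big.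
apply: uniq_perm; rewrite ?filter_uniq // => x; rewrite !mem_filter.
by case: eqVneq => //= vx; rewrite vs // vt.
Qed.

Lemma proj_del1 p q v : proj (p, q) (del1 v) = del1 (proj (p - 1, q) v) :> A.
Proof.
apply: (@eq_on_proj (proj (p, q) \o del1) (del1 \o proj (p - 1, q))) => -[a b] w /=.
rewrite -(del1_deg (proj_id (a, b) w)) !proj_projE !xpair_eqE subr_eq.
by case: ifP; rewrite ?linear0 // del1_deg ?proj_id.
Qed.

Lemma proj_del2 p q v : proj (p, q) (del2 v) = del2 (proj (p, q - 1) v) :> A.
Proof.
apply: (@eq_on_proj (proj (p, q) \o del2) (del2 \o proj (p, q - 1))) => -[a b] w /=.
rewrite -(del2_deg (proj_id (a, b) w)) !proj_projE !xpair_eqE subr_eq.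
by case: ifP; rewrite ?linear0 // del2_deg ?proj_id.
Qed.

Lemma proj_homog x v : proj x v \in homog x.
Proof. by apply/homogP; exact: proj_id. Qed.

Definition bounded : Prop :=
  exists s : seq (int * int), forall x, x \notin s ->
    forall v, v \in homog x -> v = 0.

(* the direct sum of the A^{p,q} with p + q = d *)
Definition total (d : int) : {pred A} :=
  fun v => `[< forall p q, p + q != d -> proj (p, q) v = 0 >].

Lemma total_closed d : submod_closed (total d).
Proof.
split=> [|a u v]; first by apply/asboolP => p q _; rewrite linear0.
move=> /asboolP hu /asboolP hv; apply/asboolP => p q pq.
by rewrite linearP hu // hv // scaler0 addr0.
Qed.

HB.instance Definition _ d :=
  GRing.isSubmodClosed.Build K A (total d) (total_closed d).
End DoubleComplexTheory.

Inductive cohomology_functor : Type :=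
| deRham of int
| Del1 of int & int
| Del2 of int & int
| BottChern of int & int
| Aeppli of int & int.

Section Cohomology.
Variables (K : fieldType) (A : doubleComplex K).

Definition cocycle (h : cohomology_functor) : {pred A} :=
  match h with
  | deRham d => [pred v in total d | del1 v + del2 v == 0]
  | Del1 p q => [pred v in homog (p, q) | del1 v == 0]
  | Del2 p q => [pred v in homog (p, q) | del2 v == 0]
  | BottChern p q => [pred v in homog (p, q) | (del1 v == 0) && (del2 v == 0)]
  | Aeppli p q => [pred v in homog (p, q) | del1 (del2 v) == 0]
  end.

Definition coboundary (h : cohomology_functor) : {pred A} :=
  match h with
  | deRham d => fun v =>
      `[< exists2 u : A, u \in total (d - 1) & v = del1 u + del2 u >]
  | Del1 p q => fun v => `[< exists2 u : A, u \in homog (p - 1, q) & v = del1 u >]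
  | Del2 p q => fun v => `[< exists2 u : A, u \in homog (p, q - 1) & v = del2 u >]
  | BottChern p q => fun v =>
      `[< exists2 u : A, u \in homog (p - 1, q - 1) & v = del1 (del2 u) >]
  | Aeppli p q => fun v =>
      `[< exists u w : A, [/\ u \in homog (p - 1, q), w \in homog (p, q - 1)
            & v = del1 u + del2 w] >]
  end.

Lemma cocycle_closed h : submod_closed (cocycle h).
Proof.
case: h => [d|p q|p q|p q|p q]; split=> [|a u v].
- by apply/andP; rewrite rpred0 !linear0 addr0 eqxx.
- move=> /andP[uZ /eqP du] /andP[vZ /eqP dv]; apply/andP.
  by rewrite rpredD ?rpredZ // !linearP addrACA -scalerDr du dv scaler0 addr0.
- by apply/andP; rewrite rpred0 linear0 eqxx.
- move=> /andP[uZ /eqP du] /andP[vZ /eqP dv]; apply/andP.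
  by rewrite rpredD ?rpredZ // linearP du dv scaler0 addr0.
- by apply/andP; rewrite rpred0 linear0 eqxx.
- move=> /andP[uZ /eqP du] /andP[vZ /eqP dv]; apply/andP.
  by rewrite rpredD ?rpredZ // linearP du dv scaler0 addr0.
- by apply/and3P; rewrite rpred0 !linear0 eqxx.
- move=> /and3P[uZ /eqP du /eqP eu] /and3P[vZ /eqP dv /eqP ev]; apply/and3P.
  by rewrite rpredD ?rpredZ // !linearP du dv eu ev scaler0 addr0 eqxx.
- by apply/andP; rewrite rpred0 !linear0 eqxx.
- move=> /andP[uZ /eqP du] /andP[vZ /eqP dv]; apply/andP.
  by rewrite rpredD ?rpredZ // !linearP du dv scaler0 addr0.
Qed.

HB.instance Definition _ h :=
  GRing.isSubmodClosed.Build K A (cocycle h) (cocycle_closed h).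

Lemma coboundary_closed h : submod_closed (coboundary h).
Proof.
case: h => [d|p q|p q|p q|p q]; split=> [|a x y].
- by apply/asboolP; exists 0; rewrite ?rpred0 ?linear0 ?addr0.
- move=> /asboolP[u uZ ->] /asboolP[v vZ ->]; apply/asboolP.
  exists (a *: u + v); first by rewrite rpredD ?rpredZ.
  by rewrite !linearP addrACA -scalerDr.
- by apply/asboolP; exists 0; rewrite ?rpred0 ?linear0.
- move=> /asboolP[u uZ ->] /asboolP[v vZ ->]; apply/asboolP.
  by exists (a *: u + v); rewrite ?rpredD ?rpredZ ?linearP.
- by apply/asboolP; exists 0; rewrite ?rpred0 ?linear0.
- move=> /asboolP[u uZ ->] /asboolP[v vZ ->]; apply/asboolP.
  by exists (a *: u + v); rewrite ?rpredD ?rpredZ ?linearP.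
- by apply/asboolP; exists 0; rewrite ?rpred0 ?linear0.
- move=> /asboolP[u uZ ->] /asboolP[v vZ ->]; apply/asboolP.
  by exists (a *: u + v); rewrite ?rpredD ?rpredZ ?linearP.
- by apply/asboolP; exists 0, 0; rewrite !rpred0 !linear0 addr0.
- move=> /asboolP[u [w [uZ wZ ->]]] /asboolP[v [z [vZ zZ ->]]]; apply/asboolP.
  exists (a *: u + v), (a *: w + z); rewrite !rpredD ?rpredZ //; split=> //.
  by rewrite !linearP scalerDr addrACA.
Qed.

HB.instance Definition _ h :=
  GRing.isSubmodClosed.Build K A (coboundary h) (coboundary_closed h).

Lemma coboundary_sub h : {subset coboundary h <= cocycle h}.
Proof.
have anti (v : A) : del2 (del1 v) = - del1 (del2 v) :> A.
  by apply/eqP; rewrite -addr_eq0 addrC del_anticomm.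
have in1 p q (v : A) : v \in homog (p - 1, q) -> del1 v \in homog (p, q).
  by move=> /homogP vE; apply/homogP; rewrite proj_del1 vE.
have in2 p q (v : A) : v \in homog (p, q - 1) -> del2 v \in homog (p, q).
  by move=> /homogP vE; apply/homogP; rewrite proj_del2 vE.
case: h => [d|p q|p q|p q|p q] v /asboolP.
- case=> u /asboolP uT ->; apply/andP; split.
    apply/asboolP => p q pqd; rewrite linearD proj_del1 proj_del2 !uT.
    + by rewrite !linear0 addr0.
    + by rewrite addrA (inj_eq (addIr _)).
    + by rewrite addrAC (inj_eq (addIr _)).
  by rewrite !linearD del1_sq del2_sq add0r addr0 del_anticomm.
- by case=> u uH ->; apply/andP; rewrite in1 // del1_sq.
- by case=> u uH ->; apply/andP; rewrite in2 // del2_sq.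
- case=> u uH ->; apply/and3P.
  by rewrite in1 ?in2 // del1_sq anti del2_sq linear0 oppr0 eqxx.
- case=> u [w [uH wH ->]]; apply/andP; rewrite rpredD ?in1 ?in2 //.
  by rewrite !linearD del2_sq linear0 addr0 anti linearN del1_sq oppr0.
Qed.

Definition cohomology (h : cohomology_functor) : lmodType K :=
  subquotient (cocycle h) (coboundary h).
End Cohomology.

Section DirectSum.
Variables (K : fieldType) (I : Type) (A : I -> doubleComplex K).

Let V : lmodType K := dsum (fun i => A i : lmodType K).
Let dproj x : {linear V -> V} := dsum_map (fun i => @proj K (A i) x).
Let ddel1 : {linear V -> V} := dsum_map (fun i => @del1 K (A i)).
Let ddel2 : {linear V -> V} := dsum_map (fun i => @del2 K (A i)).

Lemma dsum_eqP (f g : V) : (forall i, val f i = val g i) -> f = g.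
Proof. by move=> fg; apply/val_inj/functional_extensionality_dep. Qed.

Lemma dsum_sumE (T : Type) (s : seq T) (F : T -> V) i :
  val (\sum_(x <- s) F x) i = \sum_(x <- s) val (F x) i.
Proof.
rewrite raddf_sum; elim: s => [|x s IH]; first by rewrite !big_nil.
by rewrite !big_cons -IH.
Qed.

Lemma dproj_id x v : dproj x (dproj x v) = dproj x v.
Proof. by apply: dsum_eqP => i; exact: proj_id. Qed.

Lemma dproj_orth x y v : x != y -> dproj x (dproj y v) = 0.
Proof. by move=> xy; apply: dsum_eqP => i; exact: proj_orth. Qed.

Lemma dproj_sum v : exists2 s : seq (int * int),
  uniq s & v = \sum_(x <- s) dproj x v.
Proof.
have : finite_set (\bigcup_(i in [set i | val v i != 0])
                     [set x | proj x (val v i) != 0]).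
  by apply: bigcup_finite => [|i _]; [exact/asboolP/(valP v)|exact: proj_finite].
move=> /finite_seqP[s sE]; exists (undup s); first exact: undup_uniq.
apply: dsum_eqP => i; rewrite dsum_sumE; apply: proj_sum_sub => [|x xi].
  exact: undup_uniq.
rewrite mem_undup; suff: [set` s] x by [].
rewrite -sE; exists i; last exact: xi.
apply/eqP => vi0; have: proj x (val v i) != 0 by exact: xi.
by rewrite vi0 linear0 eqxx.
Qed.

Lemma ddel1_deg p q v :
  dproj (p, q) v = v -> dproj (p + 1, q) (ddel1 v) = ddel1 v.
Proof.
move=> vE; apply: dsum_eqP => i; apply: del1_deg.
by rewrite -[in RHS]vE.
Qed.

Lemma ddel2_deg p q v :
  dproj (p, q) v = v -> dproj (p, q + 1) (ddel2 v) = ddel2 v.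
Proof.
move=> vE; apply: dsum_eqP => i; apply: del2_deg.
by rewrite -[in RHS]vE.
Qed.

Lemma ddel1_sq v : ddel1 (ddel1 v) = 0.
Proof. by apply: dsum_eqP => i; exact: del1_sq. Qed.

Lemma ddel2_sq v : ddel2 (ddel2 v) = 0.
Proof. by apply: dsum_eqP => i; exact: del2_sq. Qed.

Lemma ddel_anticomm v : ddel1 (ddel2 v) + ddel2 (ddel1 v) = 0.
Proof. by apply: dsum_eqP => i; exact: del_anticomm. Qed.

Definition dsum_complex : doubleComplex K :=
  DoubleComplex dproj_id dproj_orth dproj_sum ddel1_deg ddel2_deg
    ddel1_sq ddel2_sq ddel_anticomm.
End DirectSum.

Definition isomorphic (K : fieldType) (A B : doubleComplex K) : Prop :=
  exists phi : {linear A -> B}, bijective phi /\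
    [/\ forall x v, phi (proj x v) = proj x (phi v),
        forall v, phi (del1 v) = del1 (phi v)
      & forall v, phi (del2 v) = del2 (phi v)].

Section Shapes.
Implicit Types (p q d : int) (S : set (int * int)).

Definition square p q : set (int * int) :=
  [set (p, q); (p - 1, q); (p, q - 1); (p - 1, q - 1)].

(* S_{1,r}^{p,q} *)
Definition even_zigzag1 (r : nat) p q : set (int * int) :=
  [set x | exists2 j : nat, (j < r)%N &
     x = (p + j%:Z, q - j%:Z) \/ x = (p + j%:Z + 1, q - j%:Z)].

(* S_{2,r}^{p,q} *)
Definition even_zigzag2 (r : nat) p q : set (int * int) :=
  [set x | exists2 j : nat, (j < r)%N &
     x = (p - j%:Z, q + j%:Z) \/ x = (p - j%:Z, q + j%:Z + 1)].

(* S_d^{p,q} *)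
Definition odd_zigzag d p q : set (int * int) :=
  if p + q <= d then
    [set (j, d - j) | j in [set j : int | p <= j <= d - q]] `|`
    [set (j, d + 1 - j) | j in [set j : int | p + 1 <= j <= d - q]]
  else
    [set (j, d - j) | j in [set j : int | d - q <= j <= p]] `|`
    [set (j, d - 1 - j) | j in [set j : int | d - q <= j <= p - 1]].

Definition is_square S : Prop := exists p q, S = square p q.

Definition is_zigzag S : Prop :=
  [\/ exists r p q, (0 < r)%N /\ S = even_zigzag1 r p q,
      exists r p q, (0 < r)%N /\ S = even_zigzag2 r p q
    | exists d p q, S = odd_zigzag d p q].

Definition dc_shape : Type := {S : set (int * int) | is_square S \/ is_zigzag S}.
End Shapes.

(* C is (a representative of the isomorphism class of) the complex C(S). *)
Definition is_shape_complex (K : fieldType) (S : set (int * int))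
    (C : doubleComplex K) : Prop :=
  [/\ forall x, S x -> has_dim (subspace (@homog K C x)) unit,
      forall x, ~ S x -> forall v : C, v \in homog x -> v = 0,
      forall p q, S (p, q) -> S (p + 1, q) ->
        set_bij [set v : C | v \in homog (p, q)]
                [set v : C | v \in homog (p + 1, q)] del1
    & forall p q, S (p, q) -> S (p, q + 1) ->
        set_bij [set v : C | v \in homog (p, q)]
                [set v : C | v \in homog (p, q + 1)] del2].

(* The cardinals |M S| are the multiplicities mult_S(A): A is isomorphic to
   the direct sum, over all shapes S, of |M S| copies of C(S). *)
Definition is_mult (K : fieldType) (A : doubleComplex K) (M : dc_shape -> Type) :
    Prop :=
  exists C : dc_shape -> doubleComplex K,
    (forall S : dc_shape, is_shape_complex (sval S) (C S)) /\
    isomorphic A (dsum_complex (fun i : {S : dc_shape & M S} => C (projT1 i))).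

(* Main.v *)
(* The functor H commutes with direct sums, so a basis of H(A) is obtained by
   collecting bases of the H(C(S)), and it suffices to see that H(C(S)) has
   dimension 0 or 1 according to S, and dimension 0 for squares.  In a fixed
   bidegree (p, q) this only depends on which neighbours of (p, q) lie in S,
   since every arrow between two points of S is bijective.  The total cohomology
   is computed by walking along the zigzag: a cocycle in the lower of the two
   total degrees is determined by its component at one end, and a vector of the
   upper total degree can be moved, modulo coboundaries, to either end.  Only
   odd zigzags leave a class, in the total degree of their longer antidiagonal. *)
From HB Require Import structures.
From mathcomp Require Import all_boot all_order all_algebra zify.
From mathcomp Require Import boolp classical_sets cardinality.
Require Import Defs.
Import Order.TTheory GRing.Theory Num.Theory.
Local Open Scope classical_set_scope.
Local Open Scope ring_scope.
Set Implicit Arguments.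
Unset Strict Implicit.
Unset Printing Implicit Defensive.

(** * Bases of subquotients *)

Section Spanning.
Variables (K : fieldType) (V : lmodType K) (B : submodClosed V).
Variables (I : Type) (b : I -> V).

(** Repetitions among the [f j] are allowed, so that two such expressions add by mere
    concatenation. *)
Definition spanned_mod (v : V) : Prop :=
  exists (n : nat) (f : 'I_n -> I) (c : 'I_n -> K),
    v - \sum_(j < n) c j *: b (f j) \in B.

Lemma spanned_mod_sub v : v \in B -> spanned_mod v.
Proof.
move=> vB; have f0 : 'I_0 -> I by case.
by exists 0%N, f0, (fun=> 0); rewrite big_ord0 subr0.
Qed.

Lemma spanned_mod_one i c v : v - c *: b i \in B -> spanned_mod v.
Proof. by move=> vB; exists 1%N, (fun=> i), (fun=> c); rewrite big_ord1. Qed.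

Lemma spanned_mod_add u v :
  spanned_mod u -> spanned_mod v -> spanned_mod (u + v).
Proof.
move=> [m [f [c uB]]] [n [g [d vB]]].
exists (m + n)%N, (fun j => match fintype.split j with inl k => f k | inr k => g k end),
  (fun j => match fintype.split j with inl k => c k | inr k => d k end).
rewrite big_split_ord /= opprD addrACA rpredD //.
- by under eq_bigr => j _ do rewrite (unsplitK (inl _ j)).
- by under eq_bigr => j _ do rewrite (unsplitK (inr _ j)).
Qed.

Lemma spanned_mod_sum (T : Type) (s : seq T) (F : T -> V) :
  (forall x, spanned_mod (F x)) -> spanned_mod (\sum_(x <- s) F x).
Proof.
move=> sF; elim/big_ind: _ => //; last exact: spanned_mod_add.
by apply: spanned_mod_sub; exact: rpred0.
Qed.
End Spanning.

Section RelativeBasis.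
Variables (K : fieldType) (V : lmodType K) (Z B : submodClosed V).

(** Representatives in [V] of a basis of [Z] modulo [B]: bases can thus be built and transported
    without handling quotient classes. *)
Definition relative_basis (I : Type) (b : I -> V) : Prop :=
  [/\ forall i, b i \in Z,
      forall (n : nat) (f : 'I_n -> I) (c : 'I_n -> K), injective f ->
        \sum_(j < n) c j *: b (f j) \in B -> forall j, c j = 0
    & forall v, v \in Z -> spanned_mod B b v].

Definition subquotient_class (v : subspace Z) : subquotient Z B :=
  \pi_(quotient_space (subspace_restr B))%qT v.

Lemma subquotient_class_eq (u v : subspace Z) :
  (subquotient_class u == subquotient_class v) = (val u - val v \in B).
Proof.
rewrite /subquotient_class -Quotient.idealrBE.
by rewrite -[LHS]/(val (u - v) \in B) raddfB.
Qed.

Lemma subquotient_class_sum n (c : 'I_n -> K) (v : 'I_n -> subspace Z) :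
  \sum_(j < n) c j *: subquotient_class (v j) =
  subquotient_class (\sum_(j < n) c j *: v j).
Proof.
elim/big_rec2: _ => [|j x y _ ->]; first by rewrite /subquotient_class raddf0.
by rewrite /subquotient_class raddfD -[c j *: _]/(quotient_scale _ _) pi_scale.
Qed.

Lemma relative_basis_has_dim (I : Type) (b : I -> V) :
  relative_basis b -> has_dim (subquotient Z B) I.
Proof.
case=> bZ bfree bspan; pose b' i : subspace Z := Subspace (bZ i).
have sumE n (f : 'I_n -> I) (c : 'I_n -> K) :
    val (\sum_(j < n) c j *: b' (f j)) = \sum_(j < n) c j *: b (f j).
  by rewrite raddf_sum; apply: eq_bigr => j _; exact: linearZ.
exists (subquotient_class \o b'); split=> [n f c f_inj|v].
  rewrite /= subquotient_class_sum => sum0; apply: (bfree n f c f_inj).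
  (* Writing the zero of [V] as [val 0] turns membership in [B] into an equality of classes. *)
  rewrite -sumE -[val _]subr0 -(raddf0 (val : subspace Z -> V)).
  rewrite -subquotient_class_eq sum0 /subquotient_class raddf0.
  exact: eqxx.
rewrite -[v]reprK -[\pi%qT _]/(subquotient_class _).
have [n [f [c vB]]] := bspan _ (valP (repr v)).
exists n, f, c; rewrite /= subquotient_class_sum; apply/eqP.
by rewrite subquotient_class_eq sumE.
Qed.

(** When [B] lies in [Z], this means that [Z / B] is a line spanned by the class of [z]. *)
Definition is_generator (z : V) : Prop :=
  [/\ z \in Z, z \notin B & forall v, v \in Z -> exists c, v - c *: z \in B].
End RelativeBasis.

(** * Functoriality of the cohomologies and transport along isomorphisms *)

Section Morphisms.
Variable K : fieldType.

Definition dc_morphism (A B : doubleComplex K) (f : {linear A -> B}) : Prop :=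
  [/\ forall x v, f (proj x v) = proj x (f v),
      forall v, f (del1 v) = del1 (f v)
    & forall v, f (del2 v) = del2 (f v)].

Section Functoriality.
Variables (A B : doubleComplex K) (f : {linear A -> B}).
Hypothesis fM : dc_morphism f.

Lemma morphism_homog x v : v \in homog x -> f v \in homog x.
Proof. by case: fM => fp _ _ /homogP vE; apply/homogP; rewrite -fp vE. Qed.

Lemma morphism_total d v : v \in total d -> f v \in total d.
Proof.
case: fM => fp _ _ /asboolP vE; apply/asboolP => p q pq.
by rewrite -fp vE // linear0.
Qed.

Lemma morphism_cocycle h v : v \in cocycle h -> f v \in cocycle h.
Proof.
case: fM => fp f1 f2; case: h => [d|p q|p q|p q|p q].
- move=> /andP[vT /eqP dv]; apply/andP; rewrite morphism_total // -f1 -f2.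
  by rewrite -linearD dv linear0.
- by move=> /andP[vH /eqP dv]; apply/andP; rewrite morphism_homog // -f1 dv linear0.
- by move=> /andP[vH /eqP dv]; apply/andP; rewrite morphism_homog // -f2 dv linear0.
- move=> /and3P[vH /eqP dv /eqP ev]; apply/and3P.
  by rewrite morphism_homog // -f1 -f2 dv ev linear0.
- move=> /andP[vH /eqP dv]; apply/andP.
  by rewrite morphism_homog // -f2 -f1 dv linear0.
Qed.

Lemma morphism_coboundary h v : v \in coboundary h -> f v \in coboundary h.
Proof.
case: fM => fp f1 f2; case: h => [d|p q|p q|p q|p q] /asboolP.
- case=> u uT ->; apply/asboolP; exists (f u); first exact: morphism_total.
  by rewrite linearD f1 f2.
- case=> u uT ->; apply/asboolP; exists (f u); first exact: morphism_homog.
  by rewrite f1.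
- case=> u uT ->; apply/asboolP; exists (f u); first exact: morphism_homog.
  by rewrite f2.
- case=> u uT ->; apply/asboolP; exists (f u); first exact: morphism_homog.
  by rewrite f1 f2.
- case=> u [w [uH wH ->]]; apply/asboolP; exists (f u), (f w).
  by rewrite linearD f1 f2; split=> //; exact: morphism_homog.
Qed.
End Functoriality.

Lemma morphism_inverse (A B : doubleComplex K) (f : {linear A -> B}) :
  dc_morphism f -> bijective f ->
  exists2 g : {linear B -> A}, cancel f g /\ cancel g f & dc_morphism g.
Proof.
case=> fp f1 f2 [g fK gK].
have gl : linear g by move=> a u v; apply: (can_inj fK); rewrite linearP !gK.
pose gL : {linear B -> A} := HB.pack g (GRing.isLinear.Build K B A *:%R g gl).
exists gL; split=> //.
- by move=> x v; apply: (can_inj fK); rewrite fp !gK.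
- by move=> v; apply: (can_inj fK); rewrite f1 !gK.
- by move=> v; apply: (can_inj fK); rewrite f2 !gK.
Qed.

(** Linear relations modulo coboundaries are carried over by the isomorphism, and expressions modulo
    coboundaries are carried back by its inverse. *)
Lemma relative_basis_iso (A B : doubleComplex K) h (I : Type) (b : I -> B) :
  isomorphic A B -> relative_basis (cocycle h) (coboundary h) b ->
  exists b' : I -> A, relative_basis (cocycle h) (coboundary h) b'.
Proof.
case=> f [f_bij fM] [bZ bfree bspan].
have [g [fK gK] gM] := morphism_inverse fM f_bij.
exists (g \o b); split=> [i|n r c r_inj sB|v vZ].
- exact: (morphism_cocycle gM).
- apply: (bfree n r c r_inj).
  have <- : f (\sum_(j < n) c j *: g (b (r j))) = \sum_(j < n) c j *: b (r j).
    by rewrite linear_sum; apply: eq_bigr => j _; rewrite linearZ gK.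
  exact: morphism_coboundary.
- have [n [r [c vB]]] := bspan _ (morphism_cocycle fM vZ).
  exists n, r, c; have := morphism_coboundary gM vB.
  rewrite linearB fK linear_sum.
  by under eq_bigr do rewrite linearZ.
Qed.
End Morphisms.

(** * Direct sums: coordinates, injections, and bases of the cohomology *)

Section DirectSumInjection.
Variables (K : fieldType) (I : Type) (V : I -> lmodType K) (i : I).

Definition dsum_coord (f : dsum V) : V i := val f i.

Lemma dsum_coord_linear : linear dsum_coord.
Proof. by move=> a f g; rewrite /dsum_coord linearP. Qed.

HB.instance Definition _ :=
  GRing.isLinear.Build K (dsum V) (V i) *:%R dsum_coord dsum_coord_linear.

(** The type of the value depends on the index, so [v] has to be transported along the classically
    decided equality [i = j]. *)
Definition dprod_inj (v : V i) : dprod V := fun j =>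
  if pselect (i = j) is left e then eq_rect i (fun j => V j : Type) v j e else 0.

Lemma dprod_inj_id v : dprod_inj v i = v.
Proof.
rewrite /dprod_inj; case: pselect => // e.
by rewrite (Prop_irrelevance e (erefl i)).
Qed.

Lemma dprod_inj_neq v j : i <> j -> dprod_inj v j = 0.
Proof. by rewrite /dprod_inj; case: pselect. Qed.

Lemma dsum_inj_subproof v : dprod_inj v \in @finite_support K I V.
Proof.
apply/asboolP; apply: (sub_finite_set _ (finite_set1 i)) => j /=.
by apply: contraNP => ij; rewrite dprod_inj_neq // => e; apply: ij.
Qed.

Definition dsum_inj (v : V i) : dsum V := Subspace (dsum_inj_subproof v).

Lemma dsum_inj_linear : linear dsum_inj.
Proof.
move=> a u v; apply/val_inj; rewrite linearP.
apply/functional_extensionality_dep => j.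
rewrite -[RHS]/(a *: dprod_inj u j + dprod_inj v j) /=.
have [e|ij] := pselect (i = j); first by case: _ / e; rewrite !dprod_inj_id.
by rewrite !dprod_inj_neq // scaler0 addr0.
Qed.

HB.instance Definition _ :=
  GRing.isLinear.Build K (V i) (dsum V) *:%R dsum_inj dsum_inj_linear.
End DirectSumInjection.

Section DirectSumBasis.
Variables (K : fieldType) (I : Type) (C : I -> doubleComplex K).
Let V i : lmodType K := C i.
Let D : doubleComplex K := dsum_complex C.
Let coord i : {linear D -> C i} := @dsum_coord K I V i.
Let inj i : {linear C i -> D} := @dsum_inj K I V i.

Lemma dsum_coord_morphism i : dc_morphism (coord i).
Proof. by []. Qed.

Lemma dsum_inj_morphism i : dc_morphism (inj i).
Proof.
(* One computation serves the projections and both differentials, since each acts coordinatewise. *)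
have injE (g : forall j, {linear C j -> C j}) v :
    inj i (g i v) = dsum_map (V := V) g (inj i v) :> dsum V.
  apply/val_inj/functional_extensionality_dep => j.
  rewrite -[LHS]/(dprod_inj (V := V) (g i v) j).
  rewrite -[RHS]/(g j (dprod_inj (V := V) v j)).
  have [e|ij] := pselect (i = j); first by case: _ / e; rewrite !dprod_inj_id.
  by rewrite !dprod_inj_neq // linear0.
split=> [x v|v|v].
- exact: (injE (fun j => @proj K (C j) x)).
- exact: (injE (fun j => @del1 K (C j))).
- exact: (injE (fun j => @del2 K (C j))).
Qed.

Lemma coord_inj i v : coord i (inj i v) = v.
Proof. exact: (dprod_inj_id (V := V)). Qed.

Lemma coord_inj_neq i j v : i <> j -> coord j (inj i v) = 0.
Proof. exact: (dprod_inj_neq (V := V)). Qed.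

Lemma dsum_decomposition (v : D) :
  exists s : seq I, v = \sum_(i <- s) inj i (coord i v).
Proof.
(* [{classic I}] supplies a decidable equality on [I], which [undup] and membership in the support
   require. *)
have [s sE] : exists s : seq {classic I}, [set i | coord i v != 0] = [set` s].
  exact/finite_seqP/asboolP/(valP (v : dsum V)).
exists (undup s); apply: dsum_eqP => i.
rewrite -[LHS]/(coord i v) -[RHS]/(coord i _) linear_sum.
have cE j : coord i (inj j (coord j v)) = if (j : {classic I}) == i then coord i v else 0.
  have [->|/eqP ji] := eqVneq (j : {classic I}) i; first exact: coord_inj.
  exact: coord_inj_neq.
under eq_bigr do rewrite cE.
have [is_|is_] := boolP ((i : {classic I}) \in s).
  rewrite (bigD1_seq (i : {classic I})) ?mem_undup ?undup_uniq //= eqxx.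
  by rewrite big1 ?addr0 // => j /negPf->.
have -> : coord i v = 0.
  apply/eqP; apply: contraNT is_ => vi0; 
  by have : [set i | coord i v != 0] i by []; rewrite sE.
by rewrite big1 // => j _; case: ifP.
Qed.

(** Freeness: as [k] and [f] are injective, the coordinate at [k (f j)] isolates the term of index
    [j], and a nonzero [c j] would make a generator a coboundary. Spanning: a cocycle is the sum of
    its coordinates, each of which is either a coboundary or a multiple of a generator modulo
    coboundaries. *)
Lemma dsum_relative_basis h (J : Type) (k : J -> I) (z : forall j, C (k j)) :
  injective k ->
  (forall j, is_generator (cocycle h) (coboundary h) (z j)) ->
  (forall i, (exists j, k j = i) \/
     {subset @cocycle K (C i) h <= @coboundary K (C i) h}) ->
  relative_basis (@cocycle K D h) (@coboundary K D h)
    (fun j => inj (k j) (z j)).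
Proof.
move=> k_inj z_gen k_onto; split=> [j|n f c f_inj sumB j|v vZ].
- by apply: (morphism_cocycle (@dsum_inj_morphism _)); case: (z_gen j).
- have := morphism_coboundary (@dsum_coord_morphism (k (f j))) sumB.
  rewrite linear_sum (bigD1 j) //= big1 => [|l lj]; last first.
    rewrite linearZ_LR coord_inj_neq; first exact: scaler0.
    by move=> /k_inj/f_inj e; rewrite e eqxx in lj.
  rewrite addr0 linearZ_LR coord_inj => czB; apply/eqP; apply: contraT => c0.
  have [_ /negP[]] := z_gen (f j).
  by rewrite -[z _](scalerK c0) rpredZ.
- have [s ->] := dsum_decomposition v; apply: spanned_mod_sum => i.
  have viZ := morphism_cocycle (@dsum_coord_morphism i) vZ.
  case: (k_onto i) => [[j ji]|acyc]; last first.
    apply: spanned_mod_sub.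
    exact: (morphism_coboundary (@dsum_inj_morphism i) (acyc _ viZ)).
  case: _ / ji viZ => viZ; have [_ _ /(_ _ viZ)[c cB]] := z_gen j.
  apply: (@spanned_mod_one _ _ _ _ _ j c).
  rewrite -linearZ -linearB.
  exact: (morphism_coboundary (@dsum_inj_morphism _)).
Qed.
End DirectSumBasis.

(** * Complexes of a given shape *)

Section Bidegrees.
Variables (K : fieldType) (A : doubleComplex K).
Implicit Types (p q d : int) (v : A).

Lemma del1_homog p p' q v : p' = p + 1 ->
  v \in homog (p, q) -> del1 v \in homog (p', q).
Proof. by move=> -> /homogP vE; apply/homogP; exact: del1_deg. Qed.

Lemma del2_homog p q q' v : q' = q + 1 ->
  v \in homog (p, q) -> del2 v \in homog (p, q').
Proof. by move=> -> /homogP vE; apply/homogP; exact: del2_deg. Qed.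

Lemma proj_homog_neq x y v : v \in homog y -> x != y -> proj x v = 0.
Proof. by move=> /homogP <- xy; exact: proj_orth. Qed.

Lemma homog_total p q d v : p + q = d -> v \in homog (p, q) -> v \in total d.
Proof.
move=> pqd vH; apply/asboolP => i j ijd; apply: (proj_homog_neq vH).
by apply: contraNneq ijd => -[-> ->]; rewrite pqd.
Qed.

Lemma total_proj_eq0 d v : v \in total d ->
  (forall p, proj (p, d - p) v = 0) -> v = 0.
Proof.
move=> /asboolP vT v0; have [s _ ->] := proj_sum v.
rewrite big1 // => -[p q] _; have [pqd|] := eqVneq (p + q) d; last exact: vT.
by have -> : q = d - p by lia.
Qed.
End Bidegrees.

Section ShapeComplex.
Variables (K : fieldType) (S : set (int * int)) (C : doubleComplex K).
Hypothesis SC : is_shape_complex S C.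
Implicit Types (p q d : int) (v : C).

Lemma shape_generator x : S x ->
  exists e : C, [/\ e \in homog x, e != 0
                  & forall v, v \in homog x -> exists c, v = c *: e].
Proof.
case: SC => + _ _ _ => /(_ x) + Sx => /(_ Sx)[b [bfree bspan]].
exists (val (b tt)); split; first exact: valP.
  apply/eqP => b0; have /eqP := oner_neq0 K; apply.
  (* Independence of the single basis vector, taken with coefficient 1, would give 1 = 0. *)
  pose f := fun _ : 'I_1 => tt; pose c := fun _ : 'I_1 => 1 : K.
  apply: (bfree 1%N f c _ _ ord0); first by move=> i j; rewrite !ord1.
  by rewrite big_ord1 scale1r; exact: val_inj.
move=> v vH; have [n [f [c vE]]] := bspan (Subspace vH).
(* All the [f j] equal [tt], so the coefficients add up on one vector. *)
exists (\sum_(j < n) c j); rewrite -[v]/(val (Subspace vH)) vE scaler_suml.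
rewrite raddf_sum; apply: eq_bigr => j _; case: (f j); exact: linearZ.
Qed.

Lemma shape_out x v : ~ S x -> v \in homog x -> v = 0.
Proof. by case: SC => _ H _ _ Sx; exact: H. Qed.

Lemma shape_del1_inj p p' q v : p' = p + 1 -> S (p, q) -> S (p', q) ->
  v \in homog (p, q) -> del1 v = 0 -> v = 0.
Proof.
move=> -> S1 S2 vH dv; case: SC => _ _ /(_ _ _ S1 S2)[_ inj _] _.
apply: inj; [exact: mem_set|apply: mem_set; exact: rpred0|by rewrite linear0].
Qed.

Lemma shape_del2_inj p q q' v : q' = q + 1 -> S (p, q) -> S (p, q') ->
  v \in homog (p, q) -> del2 v = 0 -> v = 0.
Proof.
move=> -> S1 S2 vH dv; case: SC => _ _ _ /(_ _ _ S1 S2)[_ inj _].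
apply: inj; [exact: mem_set|apply: mem_set; exact: rpred0|by rewrite linear0].
Qed.

Lemma shape_del1_surj p p' q v : p' = p + 1 -> S (p, q) -> S (p', q) ->
  v \in homog (p', q) -> exists2 u : C, u \in homog (p, q) & v = del1 u.
Proof.
move=> -> S1 S2 vH; case: SC => _ _ /(_ _ _ S1 S2)[_ _ surj] _.
by have [u uH <-] := surj v vH; exists u.
Qed.

Lemma shape_del2_surj p q q' v : q' = q + 1 -> S (p, q) -> S (p, q') ->
  v \in homog (p, q') -> exists2 u : C, u \in homog (p, q) & v = del2 u.
Proof.
move=> -> S1 S2 vH; case: SC => _ _ _ /(_ _ _ S1 S2)[_ _ surj].
by have [u uH <-] := surj v vH; exists u.
Qed.

(** Nothing is divided out: the cohomology is the whole component at [x], a line because [S x]. *)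
Lemma homog_generator h x : S x ->
  @cocycle K C h =i homog x -> (forall v, v \in coboundary h -> v = 0) ->
  exists z : C, is_generator (cocycle h) (coboundary h) z.
Proof.
move=> /shape_generator[e [eH e0 espan]] ZE B0; exists e; split.
- by rewrite ZE.
- by apply: contra e0 => /B0->.
- move=> v; rewrite ZE => /espan[c ->]; exists c.
  by rewrite subrr rpred0.
Qed.

End ShapeComplex.

(** The bigraded conditions make every vector at [(p, q)] a cocycle and leave no nonzero coboundary
    there. For Bott-Chern and Aeppli the last clause breaks the path followed by [del1 (del2 _)],
    which enters [(p, q)] through [(p - 1, q)] and leaves it through [(p, q + 1)]. *)
Definition contributes (h : cohomology_functor) (S : set (int * int)) : Prop :=
  match h with
  | deRham d => exists p q, S = odd_zigzag d p q
  | Del1 p q => [/\ S (p, q), ~ S (p + 1, q) & ~ S (p - 1, q)]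
  | Del2 p q => [/\ S (p, q), ~ S (p, q + 1) & ~ S (p, q - 1)]
  | BottChern p q => [/\ S (p, q), ~ S (p + 1, q), ~ S (p, q + 1)
      & ~ (S (p - 1, q - 1) /\ S (p - 1, q))]
  | Aeppli p q => [/\ S (p, q), ~ S (p - 1, q), ~ S (p, q - 1)
      & ~ (S (p, q + 1) /\ S (p + 1, q + 1))]
  end.

Lemma squareE a b p q :
  square a b (p, q) = ((p = a \/ p = a - 1) /\ (q = b \/ q = b - 1)).
Proof.
apply/propext; split; first by move=> [[[]|]|] [-> ->]; split; by [left|right].
by move=> [[]-> []->]; [left; left; left|left; right|left; left; right|right].
Qed.

(** A point of a square has a horizontal and a vertical neighbour in it. The Bott-Chern condition
    would leave only the top corner, which [del1 (del2 _)] reaches from the bottom one; dually, the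
    Aeppli condition would leave only the bottom corner. *)
Lemma contributes_not_square h S : contributes h S ->
  is_square S \/ is_zigzag S -> is_zigzag S.
Proof.
move=> hS [[a [b SE]]|//]; subst S; case: h hS => [d|p q|p q|p q|p q] /=.
  by move=> [p [q ->]]; constructor 3; exists d, p, q.
all: by rewrite !squareE => -[]; lia.
Qed.

(** * Cohomologies in a fixed bidegree *)

Section BigradedCohomology.
Variables (K : fieldType) (S : set (int * int)) (C : doubleComplex K).
Hypothesis SC : is_shape_complex S C.

Lemma bigraded_generator h : contributes h S -> (forall d, h <> deRham d) ->
  exists z : C, is_generator (cocycle h) (coboundary h) z.
Proof.
have subK (n : int) : n = n - 1 + 1 by lia.
case: h => [d|p q|p q|p q|p q] hS nodR; first by have := nodR d.
- case: hS => Sx Sr Sl; apply: (homog_generator SC Sx) => v.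
    apply: andb_idr => vH; apply/eqP/(shape_out SC Sr).
    exact: del1_homog vH.
  by move=> /asboolP[u uH ->]; rewrite (shape_out SC Sl uH) linear0.
- case: hS => Sx Sr Sl; apply: (homog_generator SC Sx) => v.
    apply: andb_idr => vH; apply/eqP/(shape_out SC Sr).
    exact: del2_homog vH.
  by move=> /asboolP[u uH ->]; rewrite (shape_out SC Sl uH) linear0.
- case: hS => Sx Sr Su Sd; apply: (homog_generator SC Sx) => v.
    apply: andb_idr => vH; apply/andP; split; apply/eqP.
      by apply: (shape_out SC Sr); exact: del1_homog vH.
    by apply: (shape_out SC Su); exact: del2_homog vH.
  move=> /asboolP[u uH ->]; have /not_andP[S1|S1] := Sd.
    by rewrite (shape_out SC S1 uH) !linear0.
  by rewrite (shape_out SC S1 (del2_homog (subK _) uH)) linear0.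
- case: hS => Sx Sl Sd Sr; apply: (homog_generator SC Sx) => v.
    apply: andb_idr => vH; apply/eqP.
    have vH2 := del2_homog erefl vH; have /not_andP[S1|S1] := Sr.
      by rewrite (shape_out SC S1 vH2) linear0.
    by apply: (shape_out SC S1); exact: del1_homog vH2.
  move=> /asboolP[u [w [uH wH ->]]].
  by rewrite (shape_out SC Sl uH) (shape_out SC Sd wH) !linear0 addr0.
Qed.

(** Once [(p, q)] lies in [S], some arrow or composite of two arrows at [(p, q)] stays in [S]. If it
    leaves [(p, q)] it is injective and kills the cocycle; if it enters, it is onto and produces a
    primitive. *)
Lemma bigraded_acyclic h : ~ contributes h S -> (forall d, h <> deRham d) ->
  {subset @cocycle K C h <= @coboundary K C h}.
Proof.
have subK (n : int) : n = n - 1 + 1 by lia.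
case: h => [d|p q|p q|p q|p q] hS nodR; first by have := nodR d.
all: have [Sx|Sx] := pselect (S (p, q)); last first.
all: try by move=> v /andP[vH _]; rewrite (shape_out SC Sx vH) rpred0.
- move=> v /andP[vH /eqP dv].
  have [Sr|Sr] := pselect (S (p + 1, q)).
    by rewrite (shape_del1_inj SC erefl Sx Sr vH dv) rpred0.
  have Sl : S (p - 1, q) by apply: contrapT => Sl; exact: hS.
  by apply/asboolP; exact: (shape_del1_surj SC (subK _) Sl Sx vH).
- move=> v /andP[vH /eqP dv].
  have [Sr|Sr] := pselect (S (p, q + 1)).
    by rewrite (shape_del2_inj SC erefl Sx Sr vH dv) rpred0.
  have Sl : S (p, q - 1) by apply: contrapT => Sl; exact: hS.
  by apply/asboolP; exact: (shape_del2_surj SC (subK _) Sl Sx vH).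
- move=> v /and3P[vH /eqP dv /eqP ev].
  have [Sr|Sr] := pselect (S (p + 1, q)).
    by rewrite (shape_del1_inj SC erefl Sx Sr vH dv) rpred0.
  have [Su|Su] := pselect (S (p, q + 1)).
    by rewrite (shape_del2_inj SC erefl Sx Su vH ev) rpred0.
  have [Sd Sl] : S (p - 1, q - 1) /\ S (p - 1, q).
    by apply: contrapT => Sd; exact: hS.
  have [u uH ->] := shape_del1_surj SC (subK _) Sl Sx vH.
  have [w wH ->] := shape_del2_surj SC (subK _) Sd Sl uH.
  by apply/asboolP; exists w.
- move=> v /andP[vH /eqP dv].
  have [Sl|Sl] := pselect (S (p - 1, q)).
    have [u uH ->] := shape_del1_surj SC (subK _) Sl Sx vH.
    by apply/asboolP; exists u, 0; rewrite rpred0 linear0 addr0.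
  have [Sd|Sd] := pselect (S (p, q - 1)).
    have [u uH ->] := shape_del2_surj SC (subK _) Sd Sx vH.
    by apply/asboolP; exists 0, u; rewrite rpred0 linear0 add0r.
  have [Su Sr] : S (p, q + 1) /\ S (p + 1, q + 1).
    by apply: contrapT => Sr; exact: hS.
  have ev := shape_del1_inj SC erefl Su Sr (del2_homog erefl vH) dv.
  by rewrite (shape_del2_inj SC erefl Sx Su vH ev) rpred0.
Qed.
End BigradedCohomology.

(** * Total cohomology *)

(* Both antidiagonals are parametrised by the first coordinate.  Every zigzag
   shape has this form with a <= b, a' = a or a + 1, and b' = b or b + 1. *)
Definition zigzag (d a b a' b' : int) : set (int * int) :=
  [set x | (x.1 + x.2 = d /\ a <= x.1 <= b)
        \/ (x.1 + x.2 = d + 1 /\ a' <= x.1 <= b')].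

(** The four families of zigzags realise the four choices of ends: the even ones have [(a', b')]
    equal to [(a + 1, b + 1)] and [(a, b)], the odd ones [(a + 1, b)] and [(a, b + 1)]. *)
Lemma even_zigzag1E r p q :
  even_zigzag1 r p q = zigzag (p + q) p (p + r%:Z - 1) (p + 1) (p + r%:Z).
Proof.
apply/seteqP; split=> -[i j]; rewrite /zigzag /=.
  by case=> k kr [] [-> ->]; [left|right]; lia.
case=> -[ijd ib].
  by exists (absz (i - p)%R); [lia|left; congr (_, _); lia].
by exists (absz (i - p - 1)%R); [lia|right; congr (_, _); lia].
Qed.

Lemma even_zigzag2E r p q :
  even_zigzag2 r p q = zigzag (p + q) (p - r%:Z + 1) p (p - r%:Z + 1) p.
Proof.
apply/seteqP; split=> -[i j]; rewrite /zigzag /=.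
  by case=> k kr [] [-> ->]; [left|right]; lia.
case=> -[ijd ib]; exists (absz (p - i)%R); try lia.
  by left; congr (_, _); lia.
by right; congr (_, _); lia.
Qed.

Lemma odd_zigzag_leE d p q : p + q <= d ->
  odd_zigzag d p q = zigzag d p (d - q) (p + 1) (d - q).
Proof.
rewrite /odd_zigzag => ->; apply/seteqP; split=> -[i j]; rewrite /zigzag /=.
  by case=> -[k /= kb [<- <-]]; [left|right]; lia.
by case=> -[ijd ib]; [left|right]; exists i => //; congr (_, _); lia.
Qed.

Lemma odd_zigzag_gtE d p q : d < p + q ->
  odd_zigzag d p q = zigzag (d - 1) (d - q) (p - 1) (d - q) p.
Proof.
rewrite /odd_zigzag ltNge => /negPf->; apply/seteqP; split=> -[i j]; rewrite /zigzag /=.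
  by case=> -[k /= kb [<- <-]]; [right|left]; lia.
by case=> -[ijd ib]; [right|left]; exists i => //; congr (_, _); lia.
Qed.

Section ShapeTotal.
Variables (K : fieldType) (S : set (int * int)) (C : doubleComplex K).
Hypothesis SC : is_shape_complex S C.
Implicit Types (p q d : int) (v : C).

Lemma shape_proj_out x v : ~ S x -> proj x v = 0.
Proof. by move=> Sx; apply: (shape_out SC Sx); exact: proj_homog. Qed.

Lemma shape_total_sum (s : seq (int * int)) d v : v \in total d -> uniq s ->
  (forall p q, S (p, q) -> p + q = d -> (p, q) \in s) ->
  v = \sum_(x <- s) proj x v.
Proof.
move=> /asboolP vT s_uniq sS; apply: proj_sum_sub => // -[p q] pq0.
have [Sx|Sx] := pselect (S (p, q)); last by rewrite shape_proj_out ?eqxx in pq0.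
apply: sS => //; apply/eqP; apply: contraNT pq0 => pqd.
by rewrite vT.
Qed.

Lemma shape_total_out d v :
  (forall p q, S (p, q) -> p + q <> d) -> v \in total d -> v = 0.
Proof.
move=> Sd vT; rewrite [v](@shape_total_sum [::] d) ?big_nil //.
by move=> p q /Sd.
Qed.
End ShapeTotal.

Section TotalDifferential.
Variables (K : fieldType) (A : doubleComplex K).

Lemma deRham_coboundaryP d (v : A) :
  reflect (exists2 u : A, u \in total (d - 1) & v = del1 u + del2 u)
    (v \in coboundary (deRham d)).
Proof. exact: asboolP. Qed.

Lemma deRham_cocycleP d (v : A) :
  reflect (v \in total d /\ del1 v + del2 v = 0) (v \in cocycle (deRham d)).
Proof.
by apply: (iffP andP) => -[vT dv]; split=> //; apply/eqP.
Qed.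

Lemma total_differential_homog p q d (u : A) :
  p + q = d - 1 -> u \in homog (p, q) ->
  del1 u + del2 u \in coboundary (deRham d).
Proof.
move=> pqd uH; apply/deRham_coboundaryP; exists u => //.
exact: homog_total uH.
Qed.

(** This is the recursion along an antidiagonal: where the total differential vanishes, either of
    two adjacent components determines the image of the other. *)
Lemma proj_differential i j j' (v : A) : j' = j + 1 ->
  proj (i + 1, j') (del1 v + del2 v) =
  del1 (proj (i, j') v) + del2 (proj (i + 1, j) v).
Proof.
by move=> ->; rewrite linearD proj_del1 proj_del2 !addrK.
Qed.
End TotalDifferential.

(** * Total cohomology of squares *)

Section SquareDeRham.
Variables (K : fieldType) (C : doubleComplex K) (a b : int).
Hypothesis SC : is_shape_complex (square a b) C.

(** Only three total degrees occur. At the bottom corner [del1] is injective; at the top corner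
    [del1] is onto; in the middle, subtracting a coboundary moves the cocycle to [(a, b - 1)], where
    [del2] is injective. *)
Lemma square_deRham_acyclic d :
  {subset @cocycle K C (deRham d) <= @coboundary K C (deRham d)}.
Proof.
move=> v vZ; have /deRham_cocycleP[vT dv] := vZ.
have out p q (w : C) : ~ square a b (p, q) -> w \in homog (p, q) -> w = 0.
  exact: shape_out.
have total1 p q : p + q = d -> (forall i j, square a b (i, j) -> i + j = d ->
    i = p) -> v \in homog (p, q).
  move=> pqd pq; rewrite [v](shape_total_sum SC (s := [:: (p, q)]) vT) //.
    by rewrite big_seq1 proj_homog.
  move=> i j Sij ijd; have := pq i j Sij ijd; rewrite inE => ip.
  by apply/eqP; congr (_, _); lia.
have [d0|d0] := eqVneq d (a + b - 2).
  have vH : v \in homog (a - 1, b - 1).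
    by apply: total1 => [|i j]; rewrite ?squareE; lia.
  have := proj_differential (a - 1) (j := b - 2) (j' := b - 1) v.
  rewrite dv linear0 (homogP _ _ vH).
  rewrite (proj_homog_neq vH (x := _)); last by rewrite xpair_eqE; lia.
  rewrite linear0 addr0 => e.
  rewrite (shape_del1_inj SC (p' := a) (v := v) _ _ _ vH) ?rpred0 ?squareE //; try lia.
  by rewrite -e //; lia.
have [d1|d1] := eqVneq d (a + b).
  have vH : v \in homog (a, b).
    by apply: total1 => [|i j]; rewrite ?squareE; lia.
  have [||//|u uH ->] := shape_del1_surj SC (p := a - 1) _ _ _ vH;
    rewrite ?squareE; try lia.
  have := @total_differential_homog _ _ (a - 1) b d u.
  rewrite (out (a - 1) (b + 1) (del2 u)) ?addr0; first by apply => //; lia.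
    by rewrite squareE; lia.
  exact: del2_homog uH.
have [d2|d2] := eqVneq d (a + b - 1); last first.
  rewrite (shape_total_out SC _ vT) ?rpred0 // => p q.
  by rewrite squareE; lia.
have vE : v = proj (a - 1, b) v + proj (a, b - 1) v.
  rewrite {1}[v](shape_total_sum SC (s := [:: (a - 1, b); (a, b - 1)]) vT) //.
  - by rewrite big_cons big_seq1.
  - by rewrite /= andbT inE xpair_eqE; lia.
  - by move=> p q; rewrite squareE !inE !xpair_eqE; lia.
have [||//|u uH v1E] :=
  shape_del2_surj SC (q := b - 1) _ _ _ (proj_homog (a - 1, b) v);
  rewrite ?squareE; try lia.
have dub : del1 u + del2 u \in coboundary (deRham d).
  by apply: (@total_differential_homog _ _ (a - 1) (b - 1)) => //; lia.
(* What remains of [v] after subtracting the coboundary of [u], which was chosen to cancel the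
   component at [(a - 1, b)]. *)
pose w := proj (a, b - 1) v - del1 u.
have vw : v = del1 u + del2 u + w.
  by rewrite {1}vE v1E /w (addrC (del1 u)) -addrA (addrC (del1 u)) subrK.
have wH : w \in homog (a, b - 1).
  by rewrite rpredB ?proj_homog // (del1_homog _ uH); lia.
have /deRham_cocycleP[_ dw] : w \in cocycle (deRham d).
  by rewrite -[w](addKr (del1 u + del2 u)) -vw addrC rpredB //; exact: coboundary_sub.
rewrite (out (a + 1) (b - 1) (del1 w)) ?add0r in dw; last first.
- exact: del1_homog wH.
- by rewrite squareE; lia.
rewrite vw (shape_del2_inj SC (q' := b) _ _ _ wH dw) ?addr0 ?squareE //; lia.
Qed.
End SquareDeRham.

(** * Total cohomology of zigzags *)

Section ZigzagDeRham.
Variables (K : fieldType) (C : doubleComplex K) (d a b a' b' : int).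
Hypotheses (a_b : a <= b) (a_a' : a' = a \/ a' = a + 1)
  (b_b' : b' = b \/ b' = b + 1).
Let S := zigzag d a b a' b'.
Hypothesis SC : is_shape_complex S C.
Implicit Types (i j k p q : int) (v w : C).

(** A zero component forces [del2] of its right neighbour to vanish, and [del2] is injective there;
    past [b] the components are zero anyway. *)
Lemma source_vanish_right k v : a' <= k + 1 ->
  (forall i, k < i -> proj (i, d + 1 - i) (del1 v + del2 v) = 0) ->
  proj (k, d - k) v = 0 -> forall i, k <= i -> proj (i, d - i) v = 0.
Proof.
move=> a'k dv vk i ki; have -> : i = k + (absz (i - k))%:Z by lia.
elim: (absz _) => [|n IH]; first by rewrite addr0.
move: IH; set m := k + n%:Z => IH; have -> : k + n.+1%:Z = m + 1 by lia.
have [mb|bm] := boolP (m + 1 <= b); last first.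
  by apply: (shape_proj_out SC); rewrite /S /zigzag /=; lia.
have := proj_differential m (j := d - (m + 1)) (j' := d - m) v.
have -> : proj (m + 1, d - m) (del1 v + del2 v) = 0.
  by have -> : d - m = d + 1 - (m + 1); [lia|apply: dv; lia].
rewrite IH linear0 add0r => e.
apply: (shape_del2_inj SC (q' := d - m) _ _ _ (proj_homog _ _)).
- by lia.
- by rewrite /S /zigzag /=; lia.
- by rewrite /S /zigzag /=; lia.
- by rewrite -e //; lia.
Qed.

(** The mirror walk uses injectivity of [del1]. It stops at [a], so the differential may be nonzero
    at first coordinate [a]. *)
Lemma source_vanish_left k v : k <= b' ->
  (forall i, a < i <= k -> proj (i, d + 1 - i) (del1 v + del2 v) = 0) ->
  proj (k, d - k) v = 0 -> forall i, i <= k -> proj (i, d - i) v = 0.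
Proof.
move=> kb' dv vk i ik; have -> : i = k - (absz (k - i))%:Z by lia.
elim: (absz _) => [|n IH]; first by rewrite subr0.
move: IH; set m := k - n%:Z => IH; have -> : k - n.+1%:Z = m - 1 by lia.
have [am|ma] := boolP (a < m); last first.
  by apply: (shape_proj_out SC); rewrite /S /zigzag /=; lia.
have := proj_differential (m - 1) (j := d - m) (j' := d + 1 - m) v.
rewrite subrK dv ?IH ?linear0 ?addr0; last by lia.
have -> : d - (m - 1) = d + 1 - m by lia.
move=> e; apply: (shape_del1_inj SC (p' := m) _ _ _ (proj_homog _ _)).
- by lia.
- by rewrite /S /zigzag /=; lia.
- by rewrite /S /zigzag /=; lia.
- by rewrite -e //; lia.
Qed.

(** Left of [k] there is no point of degree [d], and right of it vanishing propagates. The choice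
    [k = a] gives uniqueness of a cocycle with given left end; [k = a - 1], possible when [a' = a],
    shows that cocycles vanish. *)
Lemma source_cocycle_inj k v : a' <= k + 1 -> k <= a ->
  v \in cocycle (deRham d) -> proj (k, d - k) v = 0 -> v = 0.
Proof.
move=> a'k ka /deRham_cocycleP[vT dv] vk; apply: (total_proj_eq0 vT) => i.
have [ki|ik] := boolP (k <= i); last first.
  by apply: (shape_proj_out SC); rewrite /S /zigzag /=; lia.
by apply: source_vanish_right vk _ ki => // j _; rewrite dv linear0.
Qed.

(** The walk to the left starts at [b + 1], just outside the lower antidiagonal. Allowing a nonzero
    differential at [a] serves [target_generator], whose class lives there. *)
Lemma source_total_inj v : b' = b + 1 -> v \in total d ->
  (forall i, a < i -> proj (i, d + 1 - i) (del1 v + del2 v) = 0) -> v = 0.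
Proof.
move=> b'E vT dv; apply: (total_proj_eq0 vT) => i.
have [ib|bi] := boolP (i <= b + 1); last first.
  by apply: (shape_proj_out SC); rewrite /S /zigzag /=; lia.
apply: source_vanish_left ib => [|j jb|]; [lia|apply: dv; lia|].
by apply: (shape_proj_out SC); rewrite /S /zigzag /=; lia.
Qed.

Lemma source_coboundary0 v : v \in coboundary (deRham d) -> v = 0.
Proof.
move=> /deRham_coboundaryP[u uT ->]; rewrite (shape_total_out SC _ uT).
  by rewrite !linear0 addr0.
by move=> p q; rewrite /S /zigzag /=; lia.
Qed.

Lemma source_acyclic : a' = a \/ b' = b + 1 ->
  {subset @cocycle K C (deRham d) <= @coboundary K C (deRham d)}.
Proof.
move=> ab v vZ; suff -> : v = 0 by rewrite rpred0.
case: ab => [a'E|b'E].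
  apply: (source_cocycle_inj (k := a - 1) _ _ vZ); [lia|lia|].
  by apply: (shape_proj_out SC); rewrite /S /zigzag /=; lia.
move/deRham_cocycleP: vZ => [vT dv]; apply: (source_total_inj b'E vT) => i _.
by rewrite dv linear0.
Qed.

Lemma source_generator : a' = a + 1 -> b' = b ->
  exists z : C, is_generator (cocycle (deRham d)) (coboundary (deRham d)) z.
Proof.
move=> a'E b'E.
have [|e [eH e0 espan]] := shape_generator SC (x := (a, d - a)).
  by rewrite /S /zigzag /=; lia.
(* The cocycle is built from left to right: [z] starts with [e], [u] is its latest component, and
   the only defect of [z] is [del1 u]. *)
have build (n : nat) m : m = a + n%:Z -> m <= b -> exists z u : C,
    [/\ z \in total d, proj (a, d - a) z = e,
        u \in homog (m, d - m) & del1 z + del2 z = del1 u].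
  elim: n m => [|n IH] m mE mb.
    have {mE} -> : m = a by lia.
    exists e, e; split=> //; [|exact/homogP|].
      by apply: (homog_total _ eH); lia.
    rewrite [del2 e](shape_out SC (x := (a, d - a + 1))) ?addr0 //.
      by rewrite /S /zigzag /=; lia.
    exact: del2_homog eH.
  have [||z [u [zT za uH dz]]] := IH (m - 1); [lia|lia|].
  (* The next component is chosen so that its [del2] cancels the defect. *)
  have duH : - del1 u \in homog (m, d - (m - 1)).
    by rewrite rpredN; apply: del1_homog uH; lia.
  have [|||u' u'H u'E] := shape_del2_surj SC (q := d - m) _ _ _ duH.
  - by lia.
  - by rewrite /S /zigzag /=; lia.
  - by rewrite /S /zigzag /=; lia.
  exists (z + u'), u'; split=> //.
  - by rewrite rpredD // (homog_total _ u'H) //; lia.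
  - by rewrite linearD za (proj_homog_neq u'H) ?addr0 // xpair_eqE; lia.
  - by rewrite !linearD addrACA dz -u'E addrC subrK.
have [||z [u [zT za uH dz]]] := build (absz (b - a)) b; [lia|by []|].
(* At the right end the defect falls outside the shape, because [b' = b]. *)
have zZ : z \in cocycle (deRham d).
  apply/deRham_cocycleP; split=> //; rewrite dz.
  apply: (shape_out SC (x := (b + 1, d - b))); last exact: del1_homog uH.
  by rewrite /S /zigzag /=; lia.
exists z; split=> // [|v vZ].
  by apply: contra e0 => /source_coboundary0 z0; rewrite -za z0 linear0.
have [c vE] := espan _ (proj_homog (a, d - a) v).
exists c; rewrite [v - _](source_cocycle_inj (k := a)) ?rpred0 //; first lia.
  by rewrite rpredB ?rpredZ.
by rewrite linearB linearZ za vE subrr.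
Qed.

Definition target_reducible (x : int * int) v : Prop :=
  exists2 w, w \in homog x & v - w \in coboundary (deRham (d + 1)).

Lemma target_reducible0 x : target_reducible x 0.
Proof. by exists 0; rewrite ?subrr rpred0. Qed.

Lemma target_reducible_add x v w :
  target_reducible x v -> target_reducible x w -> target_reducible x (v + w).
Proof.
move=> [v' v'H vB] [w' w'H wB]; exists (v' + w'); first exact: rpredD.
by rewrite opprD addrACA rpredD.
Qed.

Lemma target_reducible_coboundary x v : v \in coboundary (deRham (d + 1)) ->
  target_reducible x v.
Proof. by move=> vB; exists 0; rewrite ?rpred0 ?subr0. Qed.

Lemma target_reducible_total x v :
  (forall p q w, p + q = d + 1 -> w \in homog (p, q) -> target_reducible x w) ->
  v \in total (d + 1) -> target_reducible x v.
Proof.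
move=> xH /asboolP vT; have [s _ ->] := proj_sum v; elim/big_ind: _.
- exact: target_reducible0.
- exact: target_reducible_add.
move=> [p q] _; have [pqd|pqd] := eqVneq (p + q) (d + 1).
  by apply: (xH p q) => //; exact: proj_homog.
by rewrite vT //; exact: target_reducible0.
Qed.

(* Modulo coboundaries del1 u = - del2 u, which lies one step further along the
   zigzag; the walk stops at the end of the zigzag, or just outside of it. *)
Lemma target_reduce_left p q w : p + q = d + 1 -> w \in homog (p, q) ->
  target_reducible (a, d + 1 - a) w.
Proof.
move=> pqd wH; have [Sp|Sp] := pselect (S (p, q)); last first.
  by rewrite (shape_out SC Sp wH); exact: target_reducible0.
have {Sp} ap : a <= p by move: Sp; rewrite /S /zigzag /=; lia.
have [n pE] : exists n : nat, p = a + n%:Z by exists (absz (p - a)%R); lia.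
elim: n p q w pqd wH pE {ap} => [|n IH] p q w pqd wH pE.
  exists w; last by rewrite subrr rpred0.
  by have -> : (a, d + 1 - a) = (p, q) by congr (_, _); lia.
have [Sp|Sp] := pselect (S (p, q)); last first.
  by rewrite (shape_out SC Sp wH); exact: target_reducible0.
have [|||u uH ->] := shape_del1_surj SC (p := p - 1) _ _ _ wH.
- by lia.
- by move: Sp; rewrite /S /zigzag /=; lia.
- by [].
rewrite -[del1 u](addrK (del2 u)); apply: target_reducible_add.
  apply: target_reducible_coboundary.
  by apply: total_differential_homog uH; lia.
apply: (IH (p - 1) (q + 1)); [lia| |lia].
by rewrite rpredN; exact: del2_homog uH.
Qed.

Lemma target_reduce_right p q w : p + q = d + 1 -> w \in homog (p, q) ->
  target_reducible (b + 1, d - b) w.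
Proof.
move=> pqd wH; have [Sp|Sp] := pselect (S (p, q)); last first.
  by rewrite (shape_out SC Sp wH); exact: target_reducible0.
have {Sp} pb : p <= b + 1 by move: Sp; rewrite /S /zigzag /=; lia.
have [n pE] : exists n : nat, p = b + 1 - n%:Z.
  by exists (absz (b + 1 - p)%R); lia.
elim: n p q w pqd wH pE {pb} => [|n IH] p q w pqd wH pE.
  exists w; last by rewrite subrr rpred0.
  by have -> : (b + 1, d - b) = (p, q) by congr (_, _); lia.
have [Sp|Sp] := pselect (S (p, q)); last first.
  by rewrite (shape_out SC Sp wH); exact: target_reducible0.
have [|||u uH ->] := shape_del2_surj SC (q := q - 1) _ _ _ wH.
- by lia.
- by move: Sp; rewrite /S /zigzag /=; lia.
- by [].
rewrite -[del2 u](addKr (del1 u)) (addrC (- _)); apply: target_reducible_add.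
  apply: target_reducible_coboundary.
  by apply: total_differential_homog uH; lia.
apply: (IH (p + 1) (q - 1)); [lia| |lia].
by rewrite rpredN; exact: del1_homog uH.
Qed.

(** The end towards which vectors are moved lies outside the shape: the left one if [a' = a + 1],
    the right one if [b' = b]. *)
Lemma target_acyclic : a' = a + 1 \/ b' = b ->
  {subset @cocycle K C (deRham (d + 1)) <= @coboundary K C (deRham (d + 1))}.
Proof.
move=> ab v /deRham_cocycleP[vT _].
have [x Sx [w wH]] : exists2 x, ~ S x & target_reducible x v.
  case: ab => abE.
    exists (a, d + 1 - a).
      by rewrite /S /zigzag /=; lia.
    exact: target_reducible_total target_reduce_left vT.
  exists (b + 1, d - b); first by rewrite /S /zigzag /=; lia.
  exact: target_reducible_total target_reduce_right vT.
by rewrite (shape_out SC Sx wH) subr0.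
Qed.

Lemma target_generator : a' = a -> b' = b + 1 ->
  exists z : C,
    is_generator (cocycle (deRham (d + 1))) (coboundary (deRham (d + 1))) z.
Proof.
move=> a'E b'E.
have [|e [eH e0 espan]] := shape_generator SC (x := (a, d + 1 - a)).
  by rewrite /S /zigzag /=; lia.
exists e; split.
- apply/deRham_cocycleP; split; first by apply: (homog_total _ eH); lia.
  rewrite (shape_out SC (x := (a + 1, d + 1 - a)) _ (del1_homog _ eH)) //.
    rewrite (shape_out SC (x := (a, d + 1 - a + 1)) _ (del2_homog _ eH)) ?addr0 //.
    by rewrite /S /zigzag /=; lia.
  by rewrite /S /zigzag /=; lia.
(* A primitive [u] of [e] has zero differential at first coordinates beyond [a], hence is itself
   zero. *)
- apply: contra e0 => /deRham_coboundaryP[u]; rewrite addrK => uT eE.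
  rewrite eE (source_total_inj b'E uT) ?linear0 ?addr0 // => i ai.
  by rewrite -eE (proj_homog_neq eH) // xpair_eqE; lia.
- move=> v /deRham_cocycleP[vT _].
  have [w wH] := target_reducible_total target_reduce_left vT.
  by have [c ->] := espan _ wH; exists c.
Qed.

Lemma zigzag_acyclic_other n : n <> d -> n <> d + 1 ->
  {subset @cocycle K C (deRham n) <= @coboundary K C (deRham n)}.
Proof.
move=> nd nd1 v /deRham_cocycleP[vT _].
rewrite (shape_total_out SC _ vT) ?rpred0 // => p q.
by rewrite /S /zigzag /=; lia.
Qed.
End ZigzagDeRham.

(** * All cohomologies of a single shape *)

Section ShapeCohomology.
Variables (K : fieldType) (S : set (int * int)) (C : doubleComplex K).
Hypothesis SC : is_shape_complex S C.

Lemma deRham_generator d : contributes (deRham d) S ->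
  exists z : C, is_generator (cocycle (deRham d)) (coboundary (deRham d)) z.
Proof.
case=> p [q SE]; move: SC; rewrite SE; case: (lerP (p + q) d) => pqd.
  by rewrite odd_zigzag_leE // => zC; apply: (source_generator _ _ _ zC); lia.
(* Here the longer antidiagonal is the upper one, so the zigzag is based in degree [d - 1]. *)
rewrite odd_zigzag_gtE // => zC; rewrite -[d](subrK 1).
by apply: (target_generator _ _ _ zC); lia.
Qed.

Lemma deRham_acyclic d : is_square S \/ is_zigzag S ->
  ~ contributes (deRham d) S ->
  {subset @cocycle K C (deRham d) <= @coboundary K C (deRham d)}.
Proof.
move=> S_shape Sd; case: S_shape => [[a [b SE]]|].
  by move: SC; rewrite SE => sC; exact: (square_deRham_acyclic sC).
(* The two implications exclude the end configurations of odd zigzags that leave a class in degree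
   [d]. *)
have zigzag_acyclic e a b a' b' : a <= b -> a' = a \/ a' = a + 1 ->
    b' = b \/ b' = b + 1 -> (d = e -> a' = a \/ b' = b + 1) ->
    (d = e + 1 -> a' = a + 1 \/ b' = b) -> is_shape_complex (zigzag e a b a' b') C ->
    {subset @cocycle K C (deRham d) <= @coboundary K C (deRham d)}.
  move=> ab aa' bb' de de1 zC.
  have [E|/eqP ne] := eqVneq d e.
    by rewrite E; apply: (source_acyclic ab aa' bb' zC); exact: de.
  have [E|/eqP ne1] := eqVneq d (e + 1).
    by rewrite E; apply: (target_acyclic ab aa' bb' zC); exact: de1.
  exact: (zigzag_acyclic_other ab aa' bb' zC ne ne1).
case=> [[r [p [q [r0 SE]]]]|[r [p [q [r0 SE]]]]|[e [p [q SE]]]]; move: SC.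
- by rewrite SE even_zigzag1E; apply: zigzag_acyclic; lia.
- by rewrite SE even_zigzag2E; apply: zigzag_acyclic; lia.
- have de : d <> e by move=> de; apply: Sd; exists p, q; rewrite de.
  rewrite SE; case: (lerP (p + q) e) => pqe.
    by rewrite odd_zigzag_leE //; apply: zigzag_acyclic; lia.
  by rewrite odd_zigzag_gtE //; apply: zigzag_acyclic; lia.
Qed.

Lemma contributes_generator h : contributes h S ->
  exists z : C, is_generator (cocycle h) (coboundary h) z.
Proof.
move=> hS; have [[d hE]|nodR] := pselect (exists d, h = deRham d).
  by move: hS; rewrite hE; exact: deRham_generator.
by apply: (bigraded_generator SC hS) => d hE; apply: nodR; exists d.
Qed.

Lemma not_contributes_acyclic h : is_square S \/ is_zigzag S ->
  ~ contributes h S -> {subset @cocycle K C h <= @coboundary K C h}.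
Proof.
move=> S_shape hS; have [[d hE]|nodR] := pselect (exists d, h = deRham d).
  by move: hS; rewrite hE; exact: deRham_acyclic.
by apply: (bigraded_acyclic SC hS) => d hE; apply: nodR; exists d.
Qed.
End ShapeCohomology.

(** * From contributing copies of shapes to summands *)

Section Reindexing.
Variables (I : Type) (T : set I) (M : I -> Type).

Definition restricted_index (Z : {Z : {i : I | T i} & M (sval Z)}) : {i & M i} :=
  existT M (sval (projT1 Z)) (projT2 Z).

(** A partial inverse restores the membership proof, which is unique by proof irrelevance. *)
Lemma restricted_index_inj : injective restricted_index.
Proof.
pose g (x : {i & M i}) : option {Z : {i : I | T i} & M (sval Z)} :=
  if pselect (T (projT1 x)) is left t
  then Some (existT (fun Z : {i : I | T i} => M (sval Z)) (exist T _ t) (projT2 x))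
  else None.
apply: (@pcan_inj _ _ _ g) => -[[i t] m]; rewrite /g /=.
by case: pselect => // t'; rewrite (Prop_irrelevance t' t).
Qed.
End Reindexing.

Theorem corollary2 (K : fieldType) (h : cohomology_functor) :
  exists T : set dc_shape,
    (forall Z : dc_shape, T Z -> is_zigzag (sval Z)) /\
    forall A : doubleComplex K, bounded A ->
    forall mult : dc_shape -> Type, is_mult A mult ->
      has_dim (cohomology A h) {Z : {Z : dc_shape | T Z} & mult (sval Z)}.
Proof.
(* This set does not involve the field. *)
pose T : set dc_shape := [set Z | contributes h (sval Z)].
exists T; split=> [[S S_shape] /= hS|A _ mult [C [CS A_iso]]].
  exact: contributes_not_square hS S_shape.
have gen (Z : {Z : dc_shape | T Z}) :
    exists z : C (sval Z), is_generator (cocycle h) (coboundary h) z.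
  have hZ : contributes h (sval (sval Z)) := svalP Z.
  exact: (contributes_generator (CS (sval Z)) hZ).
(* One generator is chosen per contributing shape and used in each copy; the pairs of a shape and a
   copy index the basis, which realises the sum of cardinals. *)
pose gen_basis Z := svalP (cid (gen Z)).
have basis := dsum_relative_basis
  (C := fun i : {S : dc_shape & mult S} => C (projT1 i))
  (@restricted_index_inj _ T mult) (fun Z => gen_basis (projT1 Z)).
have [|b /relative_basis_has_dim //] := relative_basis_iso A_iso (basis _).
move=> [S m]; have [TS|TS] := pselect (T S).
  by left; exists (existT (fun Z : {Z | T Z} => mult (sval Z)) (exist T S TS) m).
by right; exact: (not_contributes_acyclic (CS S) (svalP S) TS).
Qed.
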